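(* For any rational number $q > 1$, the additive monoid $\mathbb{N}_0[q]$ is fully elastic; that is, its set of elasticities $R(\mathbb{N}_0[q])$ is an interval in the poset $\mathbb{Q} \cup \{\infty\}$.
   Context: $\mathbb{N}_0$ denotes the nonnegative integers. For a positive real $q$, $\mathbb{N}_0[q] := \{f(q) \mid f(X) \in \mathbb{N}_0[X]\}$, where $\mathbb{N}_0[X]$ is the set of polynomials with coefficients in $\mathbb{N}_0$; it is regarded as an additive submonoid of $\mathbb{R}_{\ge 0}$. Let $M$ be a cancellative commutative monoid, written additively, whose only invertible element is $0$, and let $M^\bullet = M \setminus \{0\}$. An atom of $M$ is a nonzero $a \in M$ such that $a = b + c$ with $b, c \in M$ implies $b = 0$ or $c = 0$. $M$ is atomic if every nonzero element is a finite sum of atoms. For $M$ atomic and $x \in M^\bullet$, $\mathsf{L}(x)$ is the set of all $\ell \in \mathbb{N}_0$ such that $x = a_1 + \dots + a_\ell$ for some atoms $a_1, \dots, a_\ell$ (repetitions allowed). The elasticity of $x$ is $\rho(x) := \sup \mathsf{L}(x) / \min \mathsf{L}(x)$ (equal to $\infty$ if $\mathsf{L}(x)$ is unbounded). The set of elasticities of $M$ is $R(M) := \{\rho(x) \mid x \in M^\bullet\}$. $M$ is fully elastic if $R(M)$ is an interval in the poset $\mathbb{Q} \cup \{\infty\}$ (with the usual order and $\infty$ as top element), i.e., whenever $u, v \in R(M)$ and $w \in \mathbb{Q} \cup \{\infty\}$ satisfy $u \le w \le v$, then $w \in R(M)$. For $q > 1$ the monoid $\mathbb{N}_0[q]$ is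 atomic, so these notions apply. *)

(* Defs.v *)
From HB Require Import structures.
From mathcomp Require Import all_boot all_order all_algebra.
From mathcomp Require Import boolp classical_sets reals constructive_ereal.

Set Implicit Arguments.
Unset Strict Implicit.
Unset Printing Implicit Defensive.

Import Order.TTheory GRing.Theory Num.Theory.
Local Open Scope classical_set_scope.
Local Open Scope ring_scope.

Section Factorizations.
Variable M : nmodType.
Implicit Types (a x : M) (l : nat).

Definition atom a : Prop :=
  a != 0 /\ forall b c, a = b + c -> b = 0 \/ c = 0.

Definition lengths x : set nat :=
  [set l | exists2 a : 'I_l -> M, (forall i, atom (a i)) & x = \sum_(i < l) a i].

(* [rat] with a top element is rendered by [\bar rat], of which only the
   elements other than [-oo] are relevant.  The supremum is taken in [\bar rat],
   where an unbounded set of naturals has supremum [+oo]; on a nonempty set of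
   naturals [infimum] is the minimum.  The default values [0] are only reached
   when [lengths x] is empty, which cannot happen if [M] is atomic. *)
Definition elasticity x : \bar rat :=
  (supremum 0 [set (l%:R)%:E | l in lengths x]
   * ((infimum 0%N (lengths x))%:R^-1)%:E)%E.

Definition elasticities : set (\bar rat) :=
  [set elasticity x | x in [set x : M | x != 0]].

Definition fully_elastic : Prop :=
  forall u v w : \bar rat, elasticities u -> elasticities v ->
    w != -oo%E -> (u <= w)%E -> (w <= v)%E -> elasticities w.

End Factorizations.

Section EvaluationMonoid.
Variables (R : realType) (q : R).

Definition nat_poly_value : {pred R} :=
  [pred x | `[< exists f : {poly nat}, x = (map_poly (fun n => n%:R) f).[q] >]].

Fact nat_poly_value_addr_closed : addr_closed nat_poly_value.
Proof.
split=> [|_ _ /asboolP[f ->] /asboolP[g ->]]; apply/asboolP.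
  by exists 0; rewrite rmorph0 horner0.
by exists (f + g); rewrite rmorphD hornerD.
Qed.

HB.instance Definition _ :=
  GRing.isAddClosed.Build R nat_poly_value nat_poly_value_addr_closed.

Definition nat_poly_monoid : Type := {x : R | x \in nat_poly_value}.

HB.instance Definition _ := SubChoice.on nat_poly_monoid.
HB.instance Definition _ := GRing.SubChoice_isSubNmodule.Build R _
  nat_poly_monoid nat_poly_value_addr_closed.

End EvaluationMonoid.

Notation "''N0[' q ]" := (nat_poly_monoid q) (format "''N0[' q ]").

(* Main.v *)
Require Import Defs.
From mathcomp Require Import all_boot all_order all_algebra.
From mathcomp Require Import boolp classical_sets reals constructive_ereal.
From mathcomp Require Import zify ring lra.

(** Write q = a / b in lowest terms.  A factorization of an element of N0[q]
    into powers of q is a polynomial f with natural coefficients; its length is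
    f(1) and the element is f(q).  The relation a q^i = b q^(i+1) generates all
    others: if f and g have the same value then, coefficient by coefficient
    from degree 0 upwards, they differ by carries ([carryP]), because a is prime
    to b.  Following the carries shows that a factorization with all
    coefficients below a is shortest ([len_min]), and that one whose
    coefficients in degree at least 1 are below b is longest ([len_max]).

    If b = 1 then N0[q] = N0 and every elasticity is 1.  Let b > 1.  The powers
    of q are exactly the atoms ([atom_monomial], [monomial_atom]), and every elasticity is a rational number
    r >= 1, since each atom is at least 1 in R.  It remains to realise every
    rational r >= 1.  Let f be a shortest and g a longest factorization of the
    same element, and let S be the sum of the carries h_i that turn g into f,
    so that g(1) = f(1) + (a - b) S.  Adding one atom q^m with m large to both
    f and g increases both lengths by 1 and keeps S ([transfer_pad]).  So if
    r - 1 = p / u, it is enough to find one pair with p dividing S and p f(1)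
    at most S: padding then raises f(1) to (a - b) S u / p, where the
    elasticity is exactly 1 + p / u ([length_ratio]).

    Such pairs are built from the top degree downwards ([transfer]).  A carry h
    may be followed, one degree lower, by any h' with
    a h - b < b h' < a h + a.  The choice h' = floor (a h / b) does not lengthen
    f at all, so S can be made large while f(1) stays bounded.  To hit a
    multiple of p, it suffices that S takes p consecutive values, all with the
    same last carry ([flexible_exists]).  If a < 2 b, the carry 1 can be
    followed by 1 for free, as often as desired.  If a > 2 b, there are at least
    three admissible successors of each h, among them x and x + 1 with x + 1
    not divisible by b; both admit floor (a (x + 1) / b) as successor, so
    a detour over two degrees gives a free choice of adding 1 to S. *)

Set Implicit Arguments.
Unset Strict Implicit.

Import Order.TTheory GRing.Theory Num.Theory.
Local Open Scope ring_scope.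

Implicit Types f g : {poly nat}.

(** * Factorizations as polynomials *)

Definition len (f : {poly nat}) : nat := f.[1].

Lemma lenD f g : len (f + g) = (len f + len g)%N.
Proof. by rewrite /len hornerD. Qed.

Lemma lenC c : len c%:P = c.
Proof. by rewrite /len hornerC. Qed.

Lemma lenXn n : len 'X^n = 1%N.
Proof. by rewrite /len hornerXn expr1n. Qed.

Lemma lenMXaddC f c : len (f * 'X + c%:P) = (len f + c)%N.
Proof. by rewrite /len hornerMXaddC mulr1. Qed.

Lemma coef_MXaddC0 (f : {poly nat}) c : (f * 'X + c%:P)`_0 = c.
Proof. by rewrite coefD coefMX coefC add0r. Qed.

Lemma coef_MXaddCS (f : {poly nat}) c i : (f * 'X + c%:P)`_i.+1 = f`_i.
Proof. by rewrite coefD coefMX coefC addr0. Qed.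

(** Case analysis on the constant coefficient of an arbitrary polynomial, the
    zero polynomial included, which [poly_ind] treats apart. *)
Lemma polyMXaddC (f : {poly nat}) : exists g c, f = g * 'X + c%:P.
Proof.
elim/poly_ind: f => [|g c _]; last by exists g, c.
by exists 0, 0%N; rewrite mul0r add0r.
Qed.

Lemma polyCS (c : nat) : c.+1%:P = 1%:P + c%:P :> {poly nat}.
Proof. exact: (polyCD 1 c). Qed.

(** Splitting off one atom; this is the induction step on the length. *)
Lemma poly0_or_monomial f : f = 0 \/ exists i g, f = 'X^i + g.
Proof.
elim/poly_ind: f => [|f [|c] IH]; first by left.
  case: IH => [->|[i [g ->]]]; first by left; rewrite mul0r polyC0 addr0.
  by right; exists i.+1, (g * 'X); rewrite polyC0 addr0 mulrDl -exprSr.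
right; exists 0%N, (f * 'X + c%:P).
by rewrite expr0 polyCS addrCA.
Qed.

Lemma len_eq0 f : len f = 0%N -> f = 0.
Proof. by have [//|[i [g ->]]] := poly0_or_monomial f; rewrite lenD lenXn. Qed.

Section Value.
Variables (F : numFieldType) (q : F).

Definition value (f : {poly nat}) : F := (map_poly (fun n => n%:R) f).[q].

Lemma value0 : value 0 = 0.
Proof. by rewrite /value rmorph0 horner0. Qed.

Lemma valueD f g : value (f + g) = value f + value g.
Proof. by rewrite /value rmorphD hornerD. Qed.

Lemma valueC c : value c%:P = c%:R.
Proof. by rewrite /value map_polyC hornerC. Qed.

Lemma valueXn n : value 'X^n = q ^+ n.
Proof. by rewrite /value map_polyXn hornerXn. Qed.

Lemma valueMXaddC f c : value (f * 'X + c%:P) = value f * q + c%:R.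
Proof. by rewrite /value rmorphD rmorphM /= map_polyX map_polyC hornerMXaddC. Qed.

Lemma len_le_value f : 1 <= q -> (len f)%:R <= value f.
Proof.
move=> q1; elim/poly_ind: f => [|f c IH]; first by rewrite value0 /len horner0.
rewrite lenMXaddC valueMXaddC natrD lerD2r (le_trans IH) //.
by rewrite ler_peMr // (le_trans _ IH) // ler0n.
Qed.

Variables a b : nat.
Hypotheses (b_gt0 : (0 < b)%N) (lt_ba : (b < a)%N) (co_ab : coprime a b).
Hypothesis qE : q * b%:R = a%:R.

(** * Carries *)

Lemma value_denom f : exists n z, value f * b%:R ^+ n = z%:R.
Proof.
elim/poly_ind: f => [|f c [n [z E]]]; first by
  exists 0%N, 0%N; rewrite value0 mul0r.
exists n.+1, (z * a + c * b ^ n.+1)%N.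
rewrite valueMXaddC natrD !natrM natrX -E -qE exprS; ring.
Qed.

(** Clearing denominators, a divides b^N (c - d) for some N, hence c - d since a
    is prime to b.  The excess a e of the constant coefficient is carried as
    b e to degree 1, by a = q b. *)
Lemma carryP f g c d : (d <= c)%N ->
    value (f * 'X + c%:P) = value (g * 'X + d%:P) ->
  exists2 e, c = (d + a * e)%N & value g = value f + (b * e)%:R.
Proof.
move=> le_dc; rewrite !valueMXaddC => E.
have b0 : (b%:R : F) != 0 by rewrite pnatr_eq0 -lt0n.
have [m [y Ef]] := value_denom f; have [n [z Eg]] := value_denom g.
have q0 : q != 0.
  by apply/eqP => q0; move/eqP: qE; rewrite q0 mul0r eq_sym pnatr_eq0; lia.
have: (a %| b ^ (m + n).+1 * (c - d))%N.
  have: (b ^ (m + n).+1 * (c - d) + a * (y * b ^ n) = a * (z * b ^ m))%N.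
    apply/eqP; rewrite -(eqr_nat F) natrD !natrM natrB // !natrX -Ef -Eg -qE.
    rewrite exprS exprD -subr_eq0; apply/eqP.
    transitivity (b%:R * b%:R ^+ m * b%:R ^+ n *
      ((value f * q + c%:R) - (value g * q + d%:R))); first by ring.
    by rewrite E subrr mulr0.
  move=> Eab; have : (a %| a * (z * b ^ m))%N by apply: dvdn_mulr.
  by rewrite -Eab dvdn_addl //; apply: dvdn_mulr.
rewrite Gauss_dvdr ?coprimeXr // => /dvdnP[e Ee].
exists e; first lia.
have Ec : (c%:R : F) = d%:R + q * b%:R * e%:R.
  by rewrite qE -natrM -natrD; congr _%:R; lia.
apply: (mulIf q0); rewrite mulrDl natrM.
by apply: (addIr d%:R); rewrite -E Ec; ring.
Qed.

(** All carries go from g to f: a constant coefficient of f exceeding that of g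
    would exceed it by at least a.  A carry of e replaces a e atoms by b e. *)
Lemma len_min f g : (forall i, (f`_i)%R < a)%N -> value f = value g ->
  (len f <= len g)%N.
Proof.
elim/poly_ind: f g => [|f c IH] g fa; first by rewrite /len horner0.
have [{}g [d ->]] := polyMXaddC g => E.
have ca := fa 0%N; rewrite coef_MXaddC0 in ca.
have {}fa i : ((f`_i)%R < a)%N by have := fa i.+1; rewrite coef_MXaddCS.
rewrite !lenMXaddC; case: (leqP c d) => [le_cd|lt_dc]; last first.
  have [[|e] Ec _] := carryP (ltnW lt_dc) E; first by lia.
  by rewrite mulnS in Ec; lia.
have [e Ed Ef] := carryP le_cd (esym E).
have := IH (g + (b * e)%:P) fa.
rewrite valueD valueC lenD lenC => /(_ Ef); nia.
Qed.

Lemma q_gt0 : 0 < q.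
Proof.
rewrite -(pmulr_lgt0 _ (_ : 0 < b%:R :> F)) ?qE ltr0n //.
exact: leq_ltn_trans lt_ba.
Qed.

Lemma value_ge0 f : 0 <= value f.
Proof.
elim/poly_ind: f => [|f c IH]; first by rewrite value0.
by rewrite valueMXaddC addr_ge0 ?mulr_ge0 // ltW // q_gt0.
Qed.

(** If the constant coefficient of f were larger, a positive multiple of b would
    be carried to degree 1, where it again exceeds the coefficient of g; the
    excess would go up forever, past the degree of g. *)
Lemma coef0_le f g : (forall i, (g`_i)%R < b)%N -> value f = value g ->
  ((f`_0)%R <= (g`_0)%R)%N.
Proof.
elim/poly_ind: g f => [|g d IH] f gb; have [{}f [c ->]] := polyMXaddC f;
  rewrite coef_MXaddC0.
  rewrite value0 valueMXaddC => /eqP; rewrite paddr_eq0 ?mulr_ge0 ?value_ge0 //.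
    by rewrite pnatr_eq0 => /andP[_ /eqP->].
  exact/ltW/q_gt0.
move=> E; rewrite coef_MXaddC0 leqNgt; apply/negP => lt_dc.
have [e Ec Eg] := carryP (ltnW lt_dc) E.
have e_gt0 : (0 < e)%N by case: e Ec {Eg} => [|//]; lia.
have {}gb i : ((g`_i)%R < b)%N by have := gb i.+1; rewrite coef_MXaddCS.
have := IH (f + (b * e)%:P) gb; rewrite valueD valueC => /(_ (esym Eg)).
rewrite coefD coefC /=; have := gb 0%N.
by change (((g`_0)%R < b)%N -> ((f`_0)%R + b * e <= (g`_0)%R)%N -> False); nia.
Qed.

(** A carry out of f is excluded by [coef0_le] applied in degree 1, so every
    carry goes from g to f and shortens. *)
Lemma len_max f g : (forall i, (g`_i.+1)%R < b)%N -> value f = value g ->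
  (len f <= len g)%N.
Proof.
elim/poly_ind: f g => [|f c IH] g; first by rewrite /len horner0.
have [{}g [d ->]] := polyMXaddC g => gb E.
have {}gb i : ((g`_i)%R < b)%N by have := gb i; rewrite coef_MXaddCS.
rewrite !lenMXaddC; case: (leqP c d) => [le_cd|lt_dc].
  have [e Ed Ef] := carryP le_cd (esym E).
  have := IH (g + (b * e)%:P); rewrite valueD valueC lenD lenC => IHg.
  have: (len f <= len g + b * e)%N.
    by apply: IHg => // i; rewrite coefD coefC addr0.
  nia.
have [e Ec Eg] := carryP (ltnW lt_dc) E.
have e_gt0 : (0 < e)%N by case: e Ec {Eg} => [|//]; lia.
have := @coef0_le (f + (b * e)%:P) _ gb; rewrite valueD valueC => /(_ (esym Eg)).
rewrite coefD coefC /=; have := gb 0%N.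
by change (((g`_0)%R < b)%N -> ((f`_0)%R + b * e <= (g`_0)%R)%N ->
  (len f + c <= len g + d)%N); nia.
Qed.

(** * Building shortest and longest factorizations together *)

(** The part, in degrees at least i and divided by q^i, of a shortest
    factorization f and a longest factorization g of one element.  Here h is
    the carry from degree i - 1 to degree i of g, as it is turned into f,
    H is the sum of the later carries, and n is the length of the part of f;
    each unit of carry shortens by a - b. *)
Definition transfer h H n := exists f g : {poly nat},
  [/\ forall i, ((f`_i)%R < a)%N, forall i, ((g`_i)%R < b)%N,
      value f = value g + (b * h)%:R, len f = n
    & (len g + b * h + b * H = n + a * H)%N].

Lemma transfer0 : transfer 0 0 0.
Proof.
exists 0, 0; split=> [i|i|||]; rewrite ?coef0 ?muln0 ?addr0 //;
  last by rewrite /len horner0.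
- lia.
- by rewrite /len horner0.
Qed.

(** One degree is added at the bottom.  The two hypotheses say that
    b h' - a h, which has to be a coefficient of f minus one of g, lies strictly
    between - b and a; the smallest such coefficients are taken. *)
Lemma transfer_step h h' H n :
    (a * h < b * h' + b)%N -> (b * h' < a * h + a)%N ->
  transfer h H n -> transfer h' (H + h) (n + (b * h' - a * h)).
Proof.
move=> lo hi [f [g [fa gb E <- El]]].
exists (f * 'X + (b * h' - a * h)%N%:P), (g * 'X + (a * h - b * h')%N%:P); split.
- by case=> [|i]; rewrite ?coef_MXaddC0 ?coef_MXaddCS //; lia.
- by case=> [|i]; rewrite ?coef_MXaddC0 ?coef_MXaddCS //; lia.
- rewrite !valueMXaddC E mulrDl.
  have -> : (b * h)%:R * q = (a * h)%:R by rewrite !natrM -qE; ring.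
  by rewrite -!addrA -!natrD; congr (_ + _%:R); lia.
- by rewrite lenMXaddC.
- rewrite lenMXaddC; nia.
Qed.

(** Since b > 1, a single atom of degree above those of f and g can be added to
    both without violating the bounds on the coefficients. *)
Lemma transfer_pad h H n : (1 < b)%N -> transfer h H n -> transfer h H n.+1.
Proof.
move=> b_gt1 [f [g [fa gb E El Eg]]]; pose m := maxn (size f) (size g).
have coefb (p : {poly nat}) c : (1 < c)%N -> (size p <= m)%N ->
    (forall i, (p`_i)%R < c)%N -> forall i, (((p + 'X^m)`_i)%R < c)%N.
  move=> c1 pm pc i; rewrite coefD coefXn.
  case: eqP => [->|_]; last by rewrite addr0.
  by rewrite nth_default ?add0r.
exists (f + 'X^m), (g + 'X^m); split.
- by apply: coefb => //; [lia|exact: leq_maxl].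
- by apply: coefb => //; exact: leq_maxr.
- by rewrite !valueD E; ring.
- by rewrite lenD El lenXn addn1.
- by rewrite lenD lenXn; lia.
Qed.

Hypothesis b_gt1 : (1 < b)%N.

Lemma transfer_pad_to h H n m : (n <= m)%N -> transfer h H n -> transfer h H m.
Proof. by move=> /subnK <- Hn; elim: (m - n)%N => // k; apply: transfer_pad. Qed.

Lemma mul_div_le m : (b * (m %/ b) <= m)%N.
Proof. by rewrite mulnC leq_divM. Qed.

Lemma lt_mul_div m : (m < b * (m %/ b) + b)%N.
Proof. by rewrite -mulnSr mulnC ltn_ceil. Qed.

(** The truncated difference b (a h / b) - a h vanishes, so this step is free:
    it adds no atom to the shortest factorization. *)
Lemma transfer_greedy h H n : transfer h H n -> transfer (a * h %/ b) (H + h) n.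
Proof.
have hi := mul_div_le (a * h) => /(transfer_step (lt_mul_div (a * h))).
rewrite (_ : b * (a * h %/ b) - a * h = 0)%N ?addn0; last by apply/eqP.
by apply; lia.
Qed.

Lemma greedy_ge h : (h <= a * h %/ b)%N.
Proof. by rewrite leq_divRL // mulnC leq_mul2r (ltnW lt_ba) orbT. Qed.

(** The sum of the carries can take j + 1 consecutive values with one common
    last carry h.  Because h is common, whatever is appended in lower degrees
    preserves this freedom. *)
Definition flexible j h H B :=
  (0 < h)%N /\ forall i, (i <= j)%N ->
    exists2 n, (n <= B)%N & transfer h (H + i) n.

(** The relation b q = a, from which all constructions start. *)
Lemma transfer1 : transfer 1 0 b.
Proof.
have := @transfer_step 0 1 0 0; rewrite muln0 muln1 subn0; apply; [lia|lia|].
exact: transfer0.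
Qed.

(** The freedom comes from repeating the carry 1 if a < 2 b, and otherwise from
    the choice between h, x, y and h, x + 1, y for suitable x and y. *)
Lemma flexible_exists j : exists h H B, flexible j h H B.
Proof.
have [lt_a2b|le_2ba] := ltnP a (b * 2).
  (* Here floor (a / b) = 1, so the greedy step repeats the carry 1. *)
  exists 1%N, 0%N, b; split=> // i _; exists b => //; rewrite add0n.
  elim: i => [|i IH]; first exact: transfer1.
  have := transfer_greedy IH; rewrite muln1 addn1.
  have -> // : (a %/ b = 1)%N.
  by apply/eqP; rewrite eqn_leq -ltnS ltn_divLR ?leq_divRL //; lia.
elim: j => [|j [h [H [B [h_gt0 IH]]]]].
  exists 1%N, 0%N, b; split=> // i; rewrite leqn0 => /eqP->.
  by exists b => //; exact: transfer1.
(* The successors x and x + 1 of h have a common successor when b does not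
   divide x + 1; one of two consecutive integers is such an x + 1. *)
have [x [lo hi bx]] : exists x, [/\ (a * h < b * x + b)%N,
    (b * x + b < a * h + a)%N & ~~ (b %| x.+1)%N].
  have c1 : (a * h < b * (a * h %/ b) + b)%N by exact: lt_mul_div.
  have c2 : (b * (a * h %/ b) <= a * h)%N by exact: mul_div_le.
  (* Equality a = 2 b would contradict coprimality, as b > 1. *)
  have a2b : (a != b * 2)%N.
    apply: contraTneq co_ab => ->.
    by rewrite coprime_sym coprimeMr /coprime gcdnn; lia.
  have [dv|ndv] := boolP (b %| (a * h %/ b).+1)%N; last first.
    by exists (a * h %/ b)%N; split=> //; lia.
  exists (a * h %/ b).+1; split; [lia|lia|].
  rewrite -addn1 dvdn_addr // dvdn1; lia.
pose y := (a * x.+1 %/ b)%N.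
have y_gt0 : (0 < y)%N by have := greedy_ge x.+1; rewrite /y; lia.
have yhi : (b * y < a * x.+1)%N.
  have := mul_div_le (a * x.+1); rewrite -/y leq_eqVlt => /orP[/eqP Ey|//].
  case/negP: bx; rewrite -(Gauss_dvdr _ (_ : coprime b a)) 1?coprime_sym //.
  by rewrite -Ey dvdn_mulr.
have ylo : (a * x.+1 < b * y + b)%N by exact: lt_mul_div.
exists y, (H + h + x)%N, (B + a + a)%N; split=> // i le_ij.
(* The top value i = j + 1 goes through x + 1, all others through x. *)
case: (ltnP j i) => [lt_ji|{}le_ij].
  have [n nB /(@transfer_step _ x.+1 _ _ _ _) Hx] := IH j (leqnn j).
  have {}Hx := Hx ltac:(lia) ltac:(lia).
  have := transfer_step (h := x.+1) (h' := y) ltac:(lia) ltac:(lia) Hx.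
  rewrite (_ : H + j + h + x.+1 = H + h + x + i)%N; last lia.
  by move=> Hy; eexists; [|exact: Hy]; lia.
have [n nB /(@transfer_step _ x _ _ _ _) Hx] := IH i le_ij.
have {}Hx := Hx ltac:(lia) ltac:(lia).
have := transfer_step (h := x) (h' := y) ltac:(lia) ltac:(lia) Hx.
rewrite (_ : H + i + h + x = H + h + x + i)%N; last lia.
by move=> Hy; eexists; [|exact: Hy]; lia.
Qed.

(** Greedy steps are free and their carries never decrease, so the sum of the
    carries outgrows the fixed bound on the lengths. *)
Lemma flexible_large j N : exists h H B, flexible j h H B /\ (N * B <= H)%N.
Proof.
have [h [H [B flex]]] := flexible_exists j.
suff: forall k, exists h H, flexible j h H B /\ (k <= H)%N.
  by move=> /(_ (N * B)%N) [h' [H' ?]]; exists h', H', B.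
elim=> [|k [h' [H' [[h_gt0 IH] le_kH]]]]; first by exists h, H.
exists (a * h' %/ b)%N, (H' + h')%N; split; last lia.
split=> [|i le_ij]; first exact: leq_trans (greedy_ge h').
by have [n nB /transfer_greedy] := IH i le_ij; rewrite addnAC; exists n.
Qed.

Lemma transfer_dvd p : (0 < p)%N -> exists h H n,
  [/\ (0 < h)%N, (p %| H + h)%N, (p * n <= H)%N & transfer h H n].
Proof.
move=> p_gt0; have [h [H [B [[h_gt0 flex] le_BH]]]] := flexible_large p p.
have := ltn_pmod (H + h) p_gt0; set m := (_ %% _)%N => lt_mp.
have [n nB Hn] := flex (p - m)%N (leq_subr _ _).
exists h, (H + (p - m))%N, n; split=> //; last first.
  by rewrite (leq_trans (leq_mul (leqnn p) nB)) // (leq_trans le_BH) // leq_addr.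
rewrite addnAC {1}(divn_eq (H + h) p) -/m -addnA subnKC 1?ltnW //.
by rewrite dvdn_addr ?dvdnn // dvdn_mull.
Qed.

Lemma length_ratio (r : rat) : 1 <= r -> exists f g,
  [/\ forall i, ((f`_i)%R < a)%N, forall i, ((g`_i.+1)%R < b)%N,
      value f = value g, (0 < len f)%N & (len g)%:R = r * (len f)%:R].
Proof.
rewrite le_eqVlt => /orP[/eqP<-|r_gt1].
  exists 1%:P, 1%:P; split=> // [i|i||]; rewrite ?coefC ?lenC ?mul1r //=.
  by case: ifP => _; [exact: leq_ltn_trans lt_ba|lia].
(* With r = 1 + p / u and H + h = p t, the length (a - b) u t of f gives
   the elasticity 1 + (a - b) p t / ((a - b) u t) = r. *)
pose p := `|numq (r - 1)|%N; pose u := `|denq (r - 1)|%N.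
have u_gt0 : (0 < u)%N by rewrite absz_gt0 denq_eq0.
have p_gt0 : (0 < p)%N by rewrite absz_gt0 numq_eq0; lra.
have Er : r * u%:R = u%:R + p%:R.
  have Eu : (u%:R : rat) = (denq (r - 1))%:~R.
    by rewrite -[u%:R]/(u%:Z%:~R) absz_denq.
  have Ep : (p%:R : rat) = (numq (r - 1))%:~R.
    by rewrite -[p%:R]/(p%:Z%:~R) gez0_abs // numq_ge0; lra.
  by rewrite Ep numqE Eu; ring.
have [h [H [n [h_gt0 /dvdnP[t Et] le_nH Hn]]]] := transfer_dvd p_gt0.
have t_gt0 : (0 < t)%N by case: t Et => //; lia.
have le_nt : (n <= (a - b) * u * t)%N.
  rewrite -(leq_pmul2l p_gt0) (leq_trans le_nH) //.
  rewrite (@leq_trans (t * p)) //; first by lia.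
  by rewrite mulnC leq_mul2l leq_pmull ?orbT // muln_gt0 subn_gt0 lt_ba.
have [f [g [fa gb Ev Ef Eg]]] := transfer_pad_to le_nt Hn.
(* The last carry h comes from a h atoms 1 in the longest factorization. *)
exists (f * 'X + 0%:P), (g * 'X + (a * h)%:P); split.
- by case=> [|i]; rewrite ?coef_MXaddC0 ?coef_MXaddCS //; lia.
- by move=> i; rewrite coef_MXaddCS.
- by rewrite !valueMXaddC Ev addr0 mulrDl !natrM -qE; ring.
- by rewrite lenMXaddC Ef addn0 !muln_gt0 subn_gt0 lt_ba u_gt0.
- rewrite !lenMXaddC Ef addn0.
  have -> : (len g + a * h = (a - b) * t * (u + p))%N by nia.
  by rewrite !natrM natrD -Er; ring.
Qed.

End Value.

(** * Lengths and elasticities in a monoid *)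

Local Open Scope classical_set_scope.

Lemma supremum_max d (T : porderType d) (x0 m : T) (A : set T) :
  A m -> ubound A m -> supremum x0 A = m.
Proof.
move=> Am ubm; rewrite /supremum; case: eqP => [A0|_].
  by rewrite A0 in Am.
have sm : supremums A m by split=> // y; apply.
exact: is_subset1_supremums (xgetI x0 sm) sm.
Qed.

Lemma infimum_min d (T : porderType d) (x0 m : T) (A : set T) :
  A m -> lbound A m -> infimum x0 A = m.
Proof.
move=> Am lbm; rewrite /infimum; case: eqP => [A0|_].
  by rewrite A0 in Am.
have sm : infimums A m by split=> // y; apply.
exact: is_subset1_infimums (xgetI x0 sm) sm.
Qed.

Section Lengths.
Variable M : nmodType.
Implicit Types x y : M.

Lemma elasticityE x m n : lengths x m -> lengths x n ->
  (forall l, lengths x l -> m <= l <= n)%N ->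
  elasticity x = (n%:R / m%:R)%:E.
Proof.
move=> xm xn mn; rewrite /elasticity (@supremum_max _ _ _ n%:R%:E).
- by rewrite (infimum_min _ xm) // => l /mn /andP[].
- by exists n.
- by move=> _ [l /mn /andP[_ le_ln] <-]; rewrite lee_fin ler_nat.
Qed.

Lemma lengths_bounded x n :
    lengths x !=set0 -> (forall l, lengths x l -> l <= n)%N ->
  exists m k, [/\ lengths x m, lengths x k &
    forall l, lengths x l -> (m <= l <= k)%N].
Proof.
move=> [l0 xl0] len_n; pose P l := `[< lengths x l >].
have exP : exists l, P l by exists l0; apply/asboolP.
have leP l : P l -> (l <= n)%N by move/asboolP/len_n.
case: (ex_minnP exP) => m /asboolP xm minm.
case: (ex_maxnP exP leP) => k /asboolP xk maxk.
by exists m, k; split=> // l xl; rewrite minm ?maxk //; apply/asboolP.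
Qed.

Lemma lengths0 : lengths (0 : M) 0%N.
Proof. by exists (fun=> 0) => [[]|]; rewrite ?big_ord0. Qed.

Lemma lengths_gt0 x l : x != 0 -> lengths x l -> (0 < l)%N.
Proof. by case: l => // x0 [a _ xE]; rewrite xE big_ord0 eqxx in x0. Qed.

Lemma lengths_atom x : atom x -> lengths x 1%N.
Proof. by exists (fun=> x); rewrite ?big_ord1. Qed.

Lemma lengthsD x y l k : lengths x l -> lengths y k -> lengths (x + y) (l + k)%N.
Proof.
move=> [a aA ->] [c cA ->];
  exists (fun i => match split i with inl j => a j | inr j => c j end).
  by move=> i; case: split.
rewrite big_split_ord; congr (_ + _); apply: eq_bigr => i _.
  by case: split_ordP => j /eqP; rewrite ?eq_lshift ?eq_lrshift // => /eqP->.
by case: split_ordP => j /eqP; rewrite ?eq_rshift ?eq_rlshift // => /eqP->.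
Qed.

End Lengths.

(** * The monoid N0[q] *)

Section Monoid.
Variables (R : realType) (q : R).
Implicit Types x y z : 'N0[q].
Local Notation value := (value q).

Lemma value_in f : value f \in nat_poly_value q.
Proof. by apply/asboolP; exists f. Qed.

Definition eval f : 'N0[q] := exist _ (value f) (value_in f).

Lemma evalP (x : 'N0[q]) : exists f, x = eval f.
Proof. by case: x => x Px; have /asboolP[f E] := Px; exists f; apply: val_inj. Qed.

Lemma eval0 : eval 0 = 0.
Proof. by apply: val_inj; rewrite /= value0. Qed.

Lemma evalD f g : eval (f + g) = eval f + eval g.
Proof. by apply: val_inj; rewrite /= valueD. Qed.

Lemma eval_eq f g : value f = value g -> eval f = eval g.
Proof. by move=> E; apply: val_inj. Qed.

Lemma value_eq f g : eval f = eval g -> value f = value g.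
Proof. exact: (congr1 \val). Qed.

(** Splitting one power of q off a representation of an atom leaves 0. *)
Lemma atom_monomial x : atom x -> q != 0 -> exists i, x = eval 'X^i.
Proof.
move=> [x0 atomx] q0; have [f xE] := evalP x.
have [f0|[i [g fE]]] := poly0_or_monomial f.
  by rewrite xE f0 eval0 eqxx in x0.
exists i; rewrite fE evalD in xE; have [|g0] := atomx _ _ xE; last first.
  by rewrite xE g0 addr0.
move=> /(congr1 \val); rewrite /= valueXn => /eqP.
by rewrite expf_eq0 (negPf q0) andbF.
Qed.

Lemma lengths_eval x l : q != 0 -> lengths x l -> exists2 f, x = eval f & len f = l.
Proof.
move=> q0 [c cA ->].
have [e eE] := choice (fun i => atom_monomial (cA i) q0).
exists (\sum_(i < l) 'X^(e i)).
  rewrite (big_morph eval evalD eval0); exact: eq_bigr.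
rewrite (big_morph len lenD (_ : _ = 0%N)) /len ?horner0 //.
by under eq_bigr do rewrite -/(len _) lenXn; rewrite sum1_card card_ord.
Qed.

Lemma eval_lengths f : (forall i, atom (eval 'X^i)) -> lengths (eval f) (len f).
Proof.
move=> atomX; move: {2}(len f) (erefl (len f)) => n.
elim: n f => [|n IH] f fn.
  by rewrite fn (len_eq0 fn) eval0; exact: lengths0.
have [f0|[i [g fE]]] := poly0_or_monomial f.
  by rewrite f0 /len horner0 in fn.
rewrite {}fE lenD lenXn in fn *; rewrite evalD.
by apply: lengthsD; [exact: lengths_atom|apply: IH; case: fn].
Qed.

(** Each atom is at least 1, so the value of x bounds its lengths. *)
Lemma elasticity_bounds x : 1 <= q -> x != 0 -> lengths x !=set0 ->
  exists2 r : rat, 1 <= r & elasticity x = r%:E.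
Proof.
move=> q1 x0 nex; have q0 : q != 0 by rewrite gt_eqF // (lt_le_trans ltr01).
have [|m [k [xm xk mk]]] := @lengths_bounded _ x (Num.bound (\val x)) nex.
  move=> l /(lengths_eval q0) [f -> <-]; rewrite -(ler_nat R).
  apply: le_trans (len_le_value f q1) (ltW (archi_boundP _)).
  by apply: le_trans (len_le_value f q1).
exists (k%:R / m%:R); last exact: elasticityE.
by rewrite ler_pdivlMr ?mul1r ?ler_nat ?ltr0n ?(lengths_gt0 x0) //;
  case/andP: (mk _ xk).
Qed.

Variables a b : nat.
Hypotheses (b_gt0 : (0 < b)%N) (lt_ba : (b < a)%N) (co_ab : coprime a b).
Hypothesis qE : q * b%:R = a%:R.

(** A polynomial of length 1 that is a longest factorization of its value admits
    no splitting of that value into two nonzero parts. *)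
Lemma eval_atom g : (forall i, (g`_i.+1)%R < b)%N -> len g = 1%N -> atom (eval g).
Proof.
move=> gb g1; have le1 f : eval f = eval g -> (len f <= 1)%N.
  by move/value_eq => /(len_max b_gt0 lt_ba co_ab qE gb); rewrite g1.
split.
  apply/eqP; rewrite -eval0 => /value_eq E.
  have coef0_lt i : (((0 : {poly nat})`_i.+1)%R < b)%N by rewrite coef0.
  by have := len_max b_gt0 lt_ba co_ab qE coef0_lt E; rewrite g1 /len horner0.
move=> y z; have [f ->] := evalP y; have [h ->] := evalP z.
rewrite -evalD => /esym /le1; rewrite lenD => le_fh.
case: (posnP (len f)) => [f0|f_gt0]; first by left; rewrite (len_eq0 f0) eval0.
by right; rewrite (len_eq0 (_ : len h = 0%N)) ?eval0 //; lia.
Qed.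

(** For b = 1 the only atom is 1, and the only length of x is x itself. *)
Lemma elasticity_integer x : b = 1%N -> x != 0 -> elasticity x = 1%:E.
Proof.
move=> b1 x0; have natP y : exists c, y = eval c%:P.
  have [f ->] := evalP y; have [n [c E]] := value_denom qE f.
  by exists c; apply: eval_eq; rewrite valueC -E b1 expr1n mulr1.
have atom1 : atom (eval 1%:P).
  by apply: eval_atom => [i|]; rewrite ?lenC // coefC /=.
have atom_eq1 y : atom y -> y = eval 1%:P.
  have [[|c] ->] := natP y => [[]|[_ atomy]]; first by rewrite polyC0 eval0 eqxx.
  have E : eval c.+1%:P = eval 1%:P + eval c%:P by rewrite -evalD -polyCS.
  have [/eqP|c0] := atomy _ _ E; last by rewrite E c0 addr0.
  by case: atom1 => /negPf->.
have len_val l : lengths x l -> \val x = l%:R.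
  move=> [c cA ->]; rewrite (eq_bigr _ (fun i _ => atom_eq1 _ (cA i))).
  by rewrite sumr_const card_ord raddfMn /= valueC.
have [c xE] := natP x.
have xc : lengths x c.
  rewrite xE; elim: (c) => [|k IH].
    by rewrite polyC0 eval0; exact: lengths0.
  by rewrite polyCS evalD -[k.+1]add1n; apply: lengthsD => //; exact: lengths_atom.
have c0 := lengths_gt0 x0 xc.
rewrite (elasticityE xc xc) ?divff ?pnatr_eq0 -?lt0n // => l xl.
have := len_val _ xl; rewrite (len_val _ xc) => /eqP.
by rewrite eqr_nat => /eqP->; rewrite leqnn.
Qed.

Lemma monomial_atom i : (1 < b)%N -> atom (eval 'X^i).
Proof.
move=> b_gt1; apply: eval_atom; rewrite ?lenXn // => j; rewrite coefXn.
by case: eqP => _; [exact: b_gt1|exact: b_gt0].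
Qed.

Lemma elasticity_attained (r : rat) : (1 < b)%N -> 1 <= r ->
  exists2 x : 'N0[q], x != 0 & elasticity x = r%:E.
Proof.
move=> b_gt1 r_ge1.
have [f [g [fa gb E f_gt0 Er]]] := length_ratio b_gt0 lt_ba co_ab qE b_gt1 r_ge1.
have lenP h : lengths (eval h) (len h).
  by apply: eval_lengths => i; exact: monomial_atom.
have lf := lenP f; have lg := lenP g; rewrite -(eval_eq E) in lg.
exists (eval f).
  apply/eqP; rewrite -eval0 => /value_eq /(len_min b_gt0 lt_ba co_ab qE fa).
  by rewrite /len horner0 leqNgt f_gt0.
rewrite (elasticityE lf lg); first by rewrite Er mulfK // pnatr_eq0 -lt0n.
have q0 : q != 0 by rewrite gt_eqF // (q_gt0 b_gt0 lt_ba qE).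
move=> _ /(lengths_eval q0) [h /value_eq Eh <-].
rewrite (len_min b_gt0 lt_ba co_ab qE fa Eh).
by rewrite (len_max b_gt0 lt_ba co_ab qE gb) // -Eh.
Qed.

End Monoid.

Unset Implicit Arguments.
Local Close Scope classical_set_scope.

Theorem theorem5p1 (R : realType) (q : rat) (q_gt1 : 1 < q) :
  fully_elastic 'N0[ratr q : R].
Proof.
set Q : R := ratr q.
pose a := `|numq q|%N; pose b := `|denq q|%N.
have b_gt0 : (0 < b)%N by rewrite absz_gt0 denq_eq0.
have bE : (b%:R : rat) = (denq q)%:~R by rewrite -[b%:R]/(b%:Z%:~R) absz_denq.
have aE : (a%:R : rat) = q * b%:R.
  by rewrite bE -numqE -[a%:R]/(a%:Z%:~R) gez0_abs // numq_ge0; lra.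
have lt_ba : (b < a)%N by rewrite -(ltr_nat rat) aE ltr_pMl ?ltr0n.
have qE : Q * b%:R = a%:R by rewrite -(ratr_nat R a) aE rmorphM /= ratr_nat.
have co_ab : coprime a b := coprime_num_den q.
have q_ge1 : 1 <= Q by rewrite /Q -(rmorph1 (@ratr R)) ler_rat ltW.
move=> u v w uE vE w_noo le_uw le_wv.
have [b1|b_neq1] := eqVneq b 1%N.
  have elas1 z : elasticities 'N0[Q] z -> z = 1%:E.
    by move=> [x /= x0 <-]; exact: (elasticity_integer b_gt0 lt_ba co_ab qE b1 x0).
  suff -> : w = u by [].
  by apply/eqP; rewrite eq_le le_uw andbT (elas1 u uE) -(elas1 v vE).
have b_gt1 : (1 < b)%N by lia.
have finite z : elasticities 'N0[Q] z -> exists2 r : rat, 1 <= r & z = r%:E.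
  move=> [x /= x0 <-]; apply: elasticity_bounds => //.
  have [f ->] := evalP x; exists (len f); apply: eval_lengths => i.
  exact: (monomial_atom b_gt0 lt_ba co_ab qE).
have [s s_ge1 us] := finite u uE; have [t _ vt] := finite v vE.
case: w w_noo le_uw le_wv => [r||] // _; rewrite us vt // lee_fin => le_sr _.
have [x x0 xr] := elasticity_attained b_gt0 lt_ba co_ab qE b_gt1
  (le_trans s_ge1 le_sr).
by exists x.
Qed.
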